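(* Let $X$ be a Tychonoff space. The following are equivalent: (1) $C_{\Gamma}(X)$ is metrizable; (2) $C_{\Gamma}(X)$ is a $p$-space; (3) $C_{\Gamma}(X)$ is a $q$-space; (4) $C_{\Gamma}(X)$ is first countable; (5) $C_{\Gamma}(X)$ is a Fr\'echet space; (6) $C_{\Gamma}(X)$ is sequential; (7) $C_{\Gamma}(X)$ is a $k$-space; (8) $C_{\Gamma}(X)$ is countably tight; (9) $X$ is countably compact.
   Context: $C(X)$ is the set of all continuous functions $f:X\to\mathbb R$. The graph topology $\tau_{\Gamma}$ on $C(X)$ is the topology generated by the sets $F_U=\{f\in C(X): \text{graph}(f)\subseteq U\}$, where $U$ ranges over all nonempty open subsets of $X\times\mathbb R$; $C_{\Gamma}(X)$ denotes $(C(X),\tau_{\Gamma})$. For a space $Z$: $Z$ is Fr\'echet if for each $A\subseteq Z$ and $z\in\overline A$ there is a sequence of points of $A$ converging to $z$. $Z$ is sequential if $A\subseteq Z$ is closed whenever $A$ contains the limits of all (convergent) sequences from $A$. $Z$ is a $k$-space if $A\subseteq Z$ is closed whenever $A\cap K$ is closed in $K$ for each compact $K\subseteq Z$. $Z$ is countably tight if for each $A\subseteq Z$ and $z\in\overline A$ there is a countable $B\subseteq A$ with $z\in\overline B$. A Tychonoff space $Z$ is a $p$-space if there is a sequence $(\mathcal U_n)$ of families of open subsets of some compactification of $Z$, each family $\mathcal U_n$ covering $Z$, such that $\bigcap_n\bigcup\{U\in\mathcal U_n: z\in U\}\subseteq Z$ for every $z\in Z$. $Z$ is a $q$-space if each $z\in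 Z$ has a sequence $(U_n)$ of open neighborhoods such that whenever $z_n\in U_n$ for all $n$, the sequence $(z_n)$ has a cluster point in $Z$. *)

(* Defs.v *)
From HB Require Import structures.
From mathcomp Require Import all_boot all_order all_algebra.
From mathcomp Require Import all_classical all_reals all_analysis.

Set Implicit Arguments.
Unset Strict Implicit.
Unset Printing Implicit Defensive.

Import Order.TTheory GRing.Theory Num.Theory.
Import numFieldTopology.Exports.

Local Open Scope classical_set_scope.
Local Open Scope ring_scope.

(* [accessible_space] is T1. [completely_regular_space] is phrased with uniform
   separators; [completely_regular_spaceP] recovers the functional form. *)
Definition tychonoff_space (T : topologicalType) : Prop :=
  completely_regular_space T /\ accessible_space T.

Lemma completely_regular_spaceP (R : realType) (T : topologicalType) :
  completely_regular_space T <->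
  forall (a : T) (B : set T), closed B -> ~ B a ->
    exists f : T -> R, [/\ continuous f, range f `<=` `[0, 1],
      f a = 0 & f @` B `<=` [set 1]].
Proof.
split=> crT a B cB nBa.
  have /(@uniform_separatorP T R)[f [cf f01 f0 f1]] := crT a B cB nBa.
  by exists f; split => //; apply: f0; exists a.
apply/(@uniform_separatorP T R).
have [f [cf f01 fa f1]] := crT a B cB nBa.
by exists f; split => // _ [_ -> <-].
Qed.

Definition metrizable_space (R : realType) (T : topologicalType) : Prop :=
  exists d : T -> T -> R,
    [/\ forall x y, d x y = 0 <-> x = y,
        forall x y, d x y = d y x,
        forall x y z, d x z <= d x y + d y z &
        forall x, nbhs x = nbhs_ball_ (fun y e => [set z | d y z < e]) x].

Definition topological_embedding (S T : topologicalType) (f : S -> T) : Prop :=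
  [/\ injective f, continuous f &
      forall A : set S, open A ->
        open (f @` A : set (subspace (range f)))].

Definition compactification (S K : topologicalType) (f : S -> K) : Prop :=
  [/\ compact [set: K], hausdorff_space K, topological_embedding f &
      dense (range f)].

(* The space [T] is identified with its image [range f] in [K]. *)
Definition p_space (T : topologicalType) : Prop :=
  tychonoff_space T /\
  exists (K : topologicalType) (f : T -> K), compactification f /\
    exists U : nat -> set (set K),
      [/\ forall n, U n `<=` open,
          forall n, range f `<=` \bigcup_(V in U n) V &
          forall z : T,
            \bigcap_n \bigcup_(V in [set V | U n V /\ V (f z)]) V
              `<=` range f].

Definition q_space (T : topologicalType) : Prop :=
  forall z : T, exists U : nat -> set T,
    (forall n, open_nbhs z (U n)) /\
    forall u : nat -> T, (forall n, U n (u n)) ->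
      cluster (u @ \oo) !=set0.

Definition first_countable (T : topologicalType) : Prop :=
  forall x : T, exists B : set (set T),
    [/\ countable B, B `<=` nbhs x &
        forall A, nbhs x A -> exists2 V, B V & V `<=` A].

Definition frechet_space (T : topologicalType) : Prop :=
  forall (A : set T) (z : T), closure A z ->
    exists2 u : nat -> T, (forall n, A (u n)) & u @ \oo --> z.

Definition sequential_space (T : topologicalType) : Prop :=
  forall A : set T,
    (forall (u : nat -> T) (z : T),
      (forall n, A (u n)) -> u @ \oo --> z -> A z) ->
    closed A.

Definition k_space (T : topologicalType) : Prop :=
  forall A : set T,
    (forall K : set T, compact K -> closed (A `&` K : set (subspace K))) ->
    closed A.

Definition countably_tight (T : topologicalType) : Prop :=
  forall (A : set T) (z : T), closure A z ->
    exists B : set T, [/\ B `<=` A, countable B & closure B z].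

Definition countably_compact_space (T : topologicalType) : Prop :=
  forall (I : choiceType) (D : set I) (f : I -> set T),
    countable D -> (forall i, D i -> open (f i)) ->
    [set: T] `<=` cover D f -> finite_subset_cover D f [set: T].

Definition graph_of (X Y : Type) (f : X -> Y) : set (X * Y) :=
  [set p | p.2 = f p.1].

(* An alias: the library puts other topologies on [continuousType X Y]. *)
Definition graph_space (X Y : topologicalType) : Type := continuousType X Y.

HB.instance Definition _ (X Y : topologicalType) :=
  Choice.copy (graph_space X Y) (continuousType X Y).

HB.instance Definition _ (X Y : topologicalType) :=
  @isSubBaseTopological.Build (graph_space X Y) (set (X * Y))
    [set U : set (X * Y) | open U /\ U !=set0]
    (fun U => [set f : continuousType X Y | graph_of f `<=` U]).

(* Main.v *)
(* If X is countably compact, every open set around the graph of f contains a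
   uniform tube, so the graph topology is that of the uniform metric. If it is
   not, X carries a locally finite sequence x_n, and every box of arbitrary
   positive radii e_n around the values f(x_n) is a neighbourhood of f. Let A be
   the set of g with g(x_n) <> 0 for infinitely many n. Then 0 lies in the
   closure of A (a small supremum of bump functions is nonzero at every x_n),
   but a diagonal choice of radii shows that A contains the closure of each of its
   countable subsets. Hence C(X) is not countably tight; and since a sequence of
   A tending to w uniformly on the x_n can cluster only in A, and then only if
   w is in A, C(X) is neither a k-space nor a q-space. *)
Require Import Defs.
From mathcomp Require Import finmap lra.
From mathcomp Require Import all_boot all_order all_algebra.
From mathcomp Require Import all_classical all_reals all_analysis.
Import numFieldTopology.Exports.

Set Implicit Arguments.
Unset Strict Implicit.
Unset Printing Implicit Defensive.

Import Order.TTheory GRing.Theory Num.Theory.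

Local Open Scope classical_set_scope.
Local Open Scope ring_scope.

(** * Sequences, and implications valid in every topological space *)

Lemma filter_bigcap_nat (T : Type) (F : set_system T) (V : nat -> set T) n :
  Filter F -> (forall k, F (V k)) -> F (\bigcap_(k in `I_n) V k).
Proof.
move=> FF FV; rewrite bigcap_mkord.
elim/big_ind: _ => [||k _]; [exact: filterT|exact: filterI|exact: FV].
Qed.

Lemma countable_range_seq (T : Type) (A : set T) :
  countable A -> A !=set0 -> exists u : nat -> T, A = range u.
Proof.
move=> /countable_injP[f finj] [a Aa].
(* [u] inverts the injection [f] into the naturals and takes the default value [a] off its image. *)
have /choice[u uP] n :
    exists y, A y /\ forall b, A b -> f b = n -> y = b.
  have [[b [Ab fbn]]|H] := pselect (exists b, A b /\ f b = n).
    by exists b; split => // c Ac fcn; apply: finj; rewrite ?inE// fbn fcn.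
  by exists a; split => // b Ab fbn; case: H; exists b.
exists u; apply/seteqP; split => [b Ab|_ [n _ <-]]; last by have [] := uP n.
by exists (f b) => //; have [_] := uP (f b); apply.
Qed.

Lemma cluster_sub_closure (T : topologicalType) (u : nat -> T) (A : set T) :
  (forall n, A (u n)) -> cluster (u @ \oo) `<=` closure A.
Proof.
move=> Au z; rewrite clusterE => /(_ A); apply.
by exists 0%N => // n _; apply: Au.
Qed.

Lemma first_countable_frechet (T : topologicalType) :
  first_countable T -> frechet_space T.
Proof.
move=> fcT A z Az; have [B [cB Bz Bbase]] := fcT z.
have [v Bv] : exists v : nat -> set T, B = range v.
  apply: countable_range_seq => //.
  by have [V BV _] := Bbase setT filterT; exists V.
(* Intersecting the first n+1 basic sets makes the neighbourhoods decrease, so points chosen in them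
   converge to [z]. *)
have nbv n : nbhs z (\bigcap_(k in `I_n.+1) v k).
  by apply: filter_bigcap_nat => k; apply: Bz; rewrite Bv; exists k.
have /choice[u uP] n : exists y, A y /\ (\bigcap_(k in `I_n.+1) v k) y.
  by have [y []] := Az _ (nbv n); exists y.
exists u => [n|]; first by have [] := uP n.
move=> W /Bbase[V]; rewrite Bv => -[k _ <-] sVW.
by exists k => // n /= kn; apply: sVW; have [_] := uP n; apply; rewrite /= ltnS.
Qed.

Lemma frechet_sequential (T : topologicalType) :
  frechet_space T -> sequential_space T.
Proof. by move=> fT A Acl z /fT[u Au uz]; apply: Acl uz. Qed.

Lemma frechet_countably_tight (T : topologicalType) :
  frechet_space T -> countably_tight T.
Proof.
move=> fT A z /fT[u Au uz]; exists (range u); split.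
- by move=> _ [n _ <-].
- exact: card_image_le.
- move=> W /uz[N _ NW]; exists (u N); split; first by exists N.
  exact: (NW N (leqnn N)).
Qed.

(** A filter not clustering at [z] has a member missing a neighbourhood of [z]. That neighbourhood
    holds all but finitely many terms, so the filter lives on a finite, hence compact, set. *)
Lemma compact_cvg_seq (T : topologicalType) (u : nat -> T) (z : T) :
  u @ \oo --> z -> compact (z |` range u).
Proof.
move=> uz F FF FK; have [zF|/existsNP[G /existsNP[W]]] := pselect (cluster F z).
  by exists z; split => //; left.
move=> /not_implyP[FG /not_implyP[zW /set0P/negP/negPn/eqP GW0]].
have [N _ NW] := uz _ zW.
have FE : F (u @` `I_N).
  apply: filterS (filterI FG FK) => y [Gy [yz|[n _ uny]]].
    have : (G `&` W) y by split=> //; rewrite yz; apply: nbhs_singleton.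
    by rewrite GW0.
  exists n => //=; rewrite ltnNge; apply/negP => Nn.
  have : (G `&` W) y by split=> //; rewrite -uny; apply: NW.
  by rewrite GW0.
have [|y [[n _ <-] Fy]] := finite_compact _ FF FE.
  exact: finite_image.
by exists (u n); split => //; right; exists n.
Qed.

(** The compact test set is a convergent sequence together with its limit. *)
Lemma sequential_k_space (T : topologicalType) :
  sequential_space T -> k_space T.
Proof.
move=> sT A AK; apply: sT => u z Au uz.
have /AK/closed_subspaceP[V cV VAK] := compact_cvg_seq uz.
suff : (V `&` (z |` range u)) z by rewrite VAK => -[[]].
split; last by left.
apply: cV => W /uz[N _ NW]; exists (u N); split; last exact: (NW N (leqnn N)).
suff : (V `&` (z |` range u)) (u N) by case.
by rewrite VAK; do !split => //; right; exists N.
Qed.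

(** * Locally finite sequences in spaces that are not countably compact *)

Definition locally_finite (X : topologicalType) (x : nat -> X) :=
  forall y : X, exists2 W, nbhs y W &
    exists m, forall n, (m <= n)%N -> ~ W (x n).

(** Enumerate a countable open cover without finite subcover and let [x n] avoid its first n+1
    members. The k-th member is a neighbourhood of each of its points and contains no [x n] with n
    >= k. *)
Lemma not_countably_compact_seq (X : topologicalType) :
  ~ countably_compact_space X -> exists x : nat -> X, locally_finite x.
Proof.
move=> /existsNP[I /existsNP[D /existsNP[f]]].
move=> /not_implyP[cD /not_implyP[fo /not_implyP[fcov nfin]]].
(* An empty [D] covers only an empty [X], and is then its own finite subcover. *)
have [D0|/set0P D0] := eqVneq D set0.
  have /finite_fsetP[D' D'0] := @finite_set0 I.
  case: nfin; exists D' => [i iD'|y /fcov[i]]; last by rewrite D0.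
  by have : [set` D'] i by []; rewrite -D'0.
have [v Dv] := countable_range_seq cD D0.
have /choice[x xP] n : exists y, forall k, (k <= n)%N -> ~ f (v k) y.
  apply: contrapT => /forallNP H; apply: nfin.
  have /finite_fsetP[D' ED'] : finite_set (v @` `I_n.+1) by exact: finite_image.
  have vD' k : (k <= n)%N -> v k \in D'.
    by move=> kn; have : [set` D'] (v k) by rewrite -ED'; exists k.
  exists D' => [i iD'|y _].
    have : [set` D'] i by [].
    by rewrite -ED' => -[k _ <-]; rewrite inE Dv; exists k.
  have /existsNP[k /not_implyP[kn /contrapT fky]] := H y.
  by exists (v k) => //; apply: vD'.
exists x => y; have [i + fiy] := fcov y Logic.I; rewrite Dv => -[k _ vki].
exists (f (v k)); last by exists k => n; apply: xP.
rewrite vki; apply: open_nbhs_nbhs; split => //.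
by apply: fo; rewrite Dv -vki; exists k.
Qed.

(** * Neighbourhoods in the graph topology *)

Section graph_topology.
Import numFieldNormedType.Exports.
Variables (R : realType) (X : topologicalType).
Local Notation C := (graph_space X R).
Implicit Types (f g h : C) (U : set (X * R)).

Lemma open_graph_sub U :
  open U -> open [set g : C | graph_of g `<=` U].
Proof.
move=> oU; have [->|/set0P U0] := eqVneq U set0.
  (* The subbase excludes the empty [U]. A graph inside it forces [X] to be empty, so the set is
     either empty or everything. *)
  have [[g gU]|nX] := pselect (exists g : C, graph_of g `<=` set0); last first.
    suff -> : [set g : C | graph_of g `<=` set0] = set0 by exact: open0.
    by apply/seteqP; split => // g gU; apply: nX; exists g.
  suff -> : [set g : C | graph_of g `<=` set0] = setT by exact: openT.
  by apply/seteqP; split => // h _ [x t] _; apply: (gU (x, g x)).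
exists [set [set g : C | graph_of g `<=` U]]; last first.
  by rewrite bigcup_set1.
move=> _ ->; exists [fset U]%fset.
  by move=> V; rewrite in_fset1 => /eqP ->; rewrite inE.
by rewrite set_fset1 bigcap_set1.
Qed.

(** The subbase is closed under finite intersections up to the empty [U], since a graph lies in
    several sets exactly when it lies in their intersection. *)
Lemma nbhs_graphP f (A : set C) : nbhs f A <->
  exists2 U, open U /\ graph_of f `<=` U &
    forall g, graph_of g `<=` U -> A g.
Proof.
split=> [|[U [oU fU] UA]]; last first.
  rewrite nbhsE; exists [set g : C | graph_of g `<=` U] => //.
  by split => //; exact: open_graph_sub.
rewrite nbhsE => -[_ [[D DD <-] [B DB Bf]] sA].
have [D' D'sub EB] := DD _ DB.
exists (\bigcap_(V in [set` D']) V).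
  split.
    rewrite openE => p Dp; apply: filter_bigI => V VD'.
    have : V \in [set V : set (X * R) | open V /\ V !=set0] by exact: D'sub.
    by rewrite inE => -[oV _]; apply: open_nbhs_nbhs; split => //; apply: Dp.
  by move=> p fp V VD'; move: Bf; rewrite -EB => /(_ V VD'); apply.
move=> g gU; apply: sA; exists B => //; change (B g).
rewrite -EB => V VD' p gp.
exact: (gU p gp).
Qed.

Lemma open_tube f (e : R) : open [set p : X * R | `|p.2 - f p.1| < e].
Proof.
pose d (p : X * R) := `|p.2 - f p.1|.
have cd : continuous d.
  move=> p; apply: cvg_norm; apply: cvgB; first exact: cvg_snd.
  apply: (@continuous_comp _ _ _ fst (f : continuousType X R)) => /=.
    exact: cvg_fst.
  exact: cts_fun.
rewrite (_ : mkset _ = d @^-1` [set t | t < e]) //.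
by apply: open_comp => [p _|]; [exact: cd|exact: open_lt].
Qed.

Lemma nbhs_uniform f (e : R) :
  0 < e -> nbhs f [set g : C | forall y, `|g y - f y| < e].
Proof.
move=> e0; apply/nbhs_graphP; exists [set p : X * R | `|p.2 - f p.1| < e].
  by split; [exact: open_tube|move=> p /= ->; rewrite subrr normr0].
by move=> g gU y; apply: (gU (y, g y)).
Qed.

Lemma nbhs_box (x : nat -> X) f (e : nat -> R) : accessible_space X ->
  locally_finite x -> (forall n, 0 < e n) ->
  nbhs f [set g : C | forall n, `|g (x n) - f (x n)| < e n].
Proof.
move=> aX lfx e0; apply/nbhs_graphP.
(* [U n] restricts the graph only over [x n]. By local finiteness, all but finitely many of these
   conditions hold trivially near a given point, so their intersection is open. *)
pose U n := [set p : X * R | p.1 <> x n] `|` [set p | `|p.2 - f p.1| < e n].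
have oU n : open (U n).
  apply: openU; last exact: open_tube.
  rewrite (_ : mkset _ = fst @^-1` (~` [set x n])) //.
  apply: open_comp => [p _|]; first exact: cvg_fst.
  by rewrite openC; exact: accessible_closed_set1.
exists (\bigcap_n U n).
  split; last by move=> p pf n _; right; rewrite /= pf subrr normr0.
  rewrite openE => p Up; have [W nW [m Wm]] := lfx (p.1).
  have nU : nbhs p (\bigcap_(n in `I_m) U n).
    apply: filter_bigcap_nat => n; apply: open_nbhs_nbhs; split => //.
    exact: Up.
  have nW' : nbhs p (fst @^-1` W) by exact: cvg_fst.
  apply: filterS (filterI nW' nU) => q [Wq Uq] n _.
  have [nm|mn] := ltnP n m; first exact: Uq.
  by left => /= qxn; apply: (Wm n mn); rewrite -qxn.
move=> g gU n; have [//|] := gU (x n, g (x n)) erefl n Logic.I.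
by [].
Qed.

End graph_topology.

(** * Functions near zero with no zero on a given sequence *)

Section graph_space_sequence.
Import numFieldNormedType.Exports.
Variables (R : realType) (X : topologicalType).
Local Notation C := (graph_space X R).

Lemma decreasing_minorant (d : nat -> R) : (forall n, 0 < d n) ->
  exists c : nat -> R,
    [/\ forall n, 0 < c n, forall m n, (m <= n)%N -> c n <= c m,
        forall n, c n < d n & forall n, c n <= n.+1%:R^-1].
Proof.
(* Halving makes the bound by [d n] strict, and running minima make the sequence nonincreasing. *)
move=> d0; pose b n := \big[Num.min/1]_(k < n.+1) (d k / 2).
exists (fun n => Num.min n.+1%:R^-1 (b n)); split=> [n|m n mn|n|n].
- rewrite lt_min invr_gt0 ltr0n /=.
  by apply: lt_bigmin => // k _; rewrite divr_gt0.
- rewrite le_min !ge_min; apply/andP; split; apply/orP; [left|right].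
    by rewrite lef_pV2 ?posrE ?ltr0n// ler_nat ltnS.
  exact: (@le_bigmin_ord _ _ _ _ _ xpredT (fun k => d k / 2)).
- rewrite gt_min; apply/orP; right; apply: (@le_lt_trans _ _ (d n / 2)).
    exact: (bigmin_le _ (@ord_max n)).
  by have := d0 n; lra.
- by rewrite ge_min lexx.
Qed.

(** Only finitely many [v n] can oscillate by more than [e]. A common neighbourhood controls these,
    so all terms, and with them the suprema, move by at most [e]. *)
Lemma continuous_sup_vanishing (v : nat -> X -> R) :
  (forall n, continuous (v n)) -> (forall n y, 0 <= v n y <= n.+1%:R^-1) ->
  continuous (fun y => sup (range (v ^~ y))).
Proof.
move=> cv v01 y; apply/cvgrPdist_le => e e0.
have [N _ Ne] := near_infty_natSinv_lt (PosNum e0).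
have nV : nbhs y (\bigcap_(n in `I_N) [set z | `|v n y - v n z| <= e]).
  by apply: filter_bigcap_nat => n; have /cvgrPdist_le := cv n y; apply.
have supB z n : v n z <= sup (range (v ^~ z)).
  apply: ub_le_sup; last by exists n.
  exists 1 => _ [k _ <-]; have /andP[_ /le_trans] := v01 k z; apply.
  by rewrite invf_le1 ?ltr0n// ler1n.
apply: filterS nV => z Vz.
have vyz n : `|v n y - v n z| <= e.
  have [nN|nN] := ltnP n N; first exact: Vz.
  have /ltW := Ne n nN; rewrite /= => ne.
  have /andP[y0 y1] := v01 n y; have /andP[z0 z1] := v01 n z.
  move: (n.+1%:R^-1) ne y1 z1 => a ne y1 z1.
  by rewrite ler_norml; apply/andP; split; lra.
have vyz' n : v n y <= v n z + e /\ v n z <= v n y + e.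
  by have := vyz n; rewrite ler_norml => /andP[? ?]; split; lra.
have h1 : sup (range (v ^~ y)) <= sup (range (v ^~ z)) + e.
  apply: ge_sup; first by exists (v 0%N y), 0%N.
  move=> _ [n _ <-]; have [+ _] := vyz' n; have := supB z n; lra.
have h2 : sup (range (v ^~ z)) <= sup (range (v ^~ y)) + e.
  apply: ge_sup; first by exists (v 0%N z), 0%N.
  move=> _ [n _ <-]; have [_ +] := vyz' n; have := supB y n; lra.
by rewrite ler_norml; apply/andP; split; lra.
Qed.

(* The function is [y |-> sup_n c n * h n y], where [h n] is a bump at [x n] and
   [c] is nonincreasing: the first bump not vanishing at [y] bounds the
   supremum, so the graph stays in the prescribed open set. *)
Lemma nbhs0_nonvanishing (x : nat -> X) (B : set C) : tychonoff_space X ->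
  nbhs ((cst 0 : continuousType X R) : C) B ->
  exists2 g : C, B g & forall n, g (x n) != 0.
Proof.
move=> [/(completely_regular_spaceP R) crX _] /nbhs_graphP[U [oU U0] UB].
(* [hd n] pairs a bump at [x n] with the height of a box inside [U] whose base contains all points
   where the bump is nonzero. *)
have /choice[hd hdP] n : exists p : (X -> R) * R,
    [/\ continuous p.1, forall y, 0 <= p.1 y <= 1, p.1 (x n) = 1, 0 < p.2 &
        forall y, p.1 y != 0 -> forall t, `|t| < p.2 -> U (y, t)].
  have [[V W] /= [nV /nbhs_ballP[d /= d0 dW]] VWU] : nbhs (x n, 0) U.
    by apply: open_nbhs_nbhs; split => //; apply: U0.
  have nxV : ~ (~` V°) (x n) by apply; exact: nV.
  have [|f [cf f01 fx f1]] := crX (x n) (~` V°) _ nxV.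
    by apply: open_closedC; exact: open_interior.
  have f01' y : 0 <= f y <= 1.
    by have : [set` `[0, 1]] (f y); [apply: f01; exists y|rewrite /= in_itv].
  exists (fun y => 1 - f y, d); split => //=.
  - by move=> y; apply: cvgB; [exact: cvg_cst|exact: cf].
  - by move=> y; have /andP[? ?] := f01' y; apply/andP; split; lra.
  - by rewrite fx subr0.
  - move=> y fy t td; apply: VWU; split => /=.
      apply: contrapT => nVy; move/eqP: fy; apply.
      suff -> : f y = 1 by rewrite subrr.
      by apply: f1; exists y => // /interior_subset.
    by apply: dW; rewrite /ball /= sub0r normrN.
have [c [c0 cle cd cn]] := @decreasing_minorant (fun n => (hd n).2)
  (fun n => let: And5 _ _ _ H _ := hdP n in H).
pose v n y := c n * (hd n).1 y.
have h01 n y : 0 <= (hd n).1 y <= 1 by have [_ + _ _ _] := hdP n; apply.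
have v0 n y : 0 <= v n y.
  by have /andP[? _] := h01 n y; rewrite mulr_ge0 // ltW.
have vc n y : v n y <= c n.
  by have /andP[_ ?] := h01 n y; rewrite ler_piMr // ltW.
have cg : continuous (fun y => sup (range (v ^~ y))).
  apply: continuous_sup_vanishing => [n y|n y].
    by apply: cvgM; [exact: cvg_cst|have [+ _ _ _ _] := hdP n; apply].
  by rewrite v0 (le_trans (vc n y)).
have supB z n : v n z <= sup (range (v ^~ z)).
  apply: ub_le_sup; last by exists n.
  by exists (c 0%N) => _ [k _ <-]; rewrite (le_trans (vc k z)) // cle.
exists ((mkcts cg : continuousType X R) : C) => [|n]; last first.
  rewrite gt_eqF //; apply: lt_le_trans (supB (x n) n).
  by rewrite /v; have [_ _ -> _ _] := hdP n; rewrite mulr1.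
apply: UB => -[y t]; rewrite /graph_of /= => ->; rewrite /mkcts.
have [hy0|/existsNP exh] := pselect (forall n, (hd n).1 y = 0).
  suff -> : range (v ^~ y) = [set 0] by rewrite sup1; apply: U0.
  apply/seteqP; split => [_ [n _ <-]|_ ->]; first by rewrite /v hy0 mulr0.
  by exists 0%N; rewrite // /v hy0 mulr0.
have {}exh : exists n, (hd n).1 y != 0 by have [n /eqP] := exh; exists n.
case: (ex_minnP exh) => n hn nmin.
have [_ _ _ _ +] := hdP n; move/(_ y hn); apply.
rewrite ger0_norm; last exact: le_trans (v0 0%N y) (supB y 0%N).
apply: le_lt_trans (cd n); apply: ge_sup; first by exists (v 0%N y), 0%N.
move=> _ [k _ <-]; have [kn|nk] := ltnP k n; last exact: le_trans (cle _ _ nk).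
suff -> : v k y = 0 by exact: ltW.
rewrite /v; have [->|/nmin] := eqVneq ((hd k).1 y) 0; first by rewrite mulr0.
by rewrite leqNgt kn.
Qed.

End graph_space_sequence.

(** * Obstructions along a locally finite sequence *)

Section not_countably_compact.
Import numFieldNormedType.Exports.
Variables (R : realType) (X : topologicalType) (x : nat -> X).
Hypotheses (tX : tychonoff_space X) (lfx : locally_finite x).
Local Notation C := (graph_space X R).

Definition io_nonzero : set C :=
  [set g : C | forall N, exists2 n, (N <= n)%N & g (x n) != 0].

Let zero : C := (cst 0 : continuousType X R).

Lemma closure_io_nonzero0 : closure io_nonzero zero.
Proof.
move=> B /(nbhs0_nonvanishing x tX)[g Bg gx]; exists g; split => // N.
by exists N.
Qed.

Lemma not_io_nonzero0 : ~ io_nonzero zero.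
Proof. by move=> /(_ 0%N)[n _]; rewrite eqxx. Qed.

Lemma closed_io_nonzeroN : ~ closed io_nonzero.
Proof. by move=> /(_ zero closure_io_nonzero0); exact: not_io_nonzero0. Qed.

(* If [w] vanishes at [x n] for [n >= N], the box around [w] of radii
   [e n = min_(k <= n, u k (x n) != 0) |u k (x n)|] contains no [u k]. *)
Lemma closure_range_io_nonzero (u : nat -> C) :
  (forall k, io_nonzero (u k)) -> closure (range u) `<=` io_nonzero.
Proof.
move=> uP w clw; apply: contrapT => /existsNP[N Nw].
have {}Nw n : (N <= n)%N -> w (x n) = 0.
  by move=> Nn; apply/eqP/negPn/negP => wn; apply: Nw; exists n.
pose e n : R := \big[Num.min/1]_(k < n.+1 | u k (x n) != 0) `|u k (x n)|.
have e0 n : 0 < e n by apply: lt_bigmin => // k; rewrite normr_gt0.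
have [_ [[k _ <-] uk]] := clw _ (nbhs_box w tX.2 lfx e0).
(* n >= N makes [w] vanish at [x n], and n >= k puts [u k] among the functions entering the minimum
   [e n]. *)
have [n Nkn ukn] := uP k (maxn N k).
have := uk n; rewrite Nw ?subr0; last by rewrite (leq_trans (leq_maxl _ _) Nkn).
have kn : (k < n.+1)%N by rewrite ltnS (leq_trans (leq_maxr _ _) Nkn).
rewrite ltNge => /negP; apply; rewrite /e.
exact: (@bigmin_le_cond _ _ _ _ (Ordinal kn) _ (fun k => `|u k (x n)|)).
Qed.

(** A cluster point stays in [io_nonzero x], and it agrees with [w] at every [x n] because [u]
    converges to [w] uniformly there. *)
Lemma io_nonzero_cluster (u : nat -> C) (w : C) :
  (forall k, io_nonzero (u k)) ->
  (forall k n, `|u k (x n) - w (x n)| < k.+1%:R^-1) ->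
  cluster (u @ \oo) !=set0 -> io_nonzero w.
Proof.
move=> uP uw [h hu].
have Ah : io_nonzero h.
  apply: (closure_range_io_nonzero uP).
  by apply: cluster_sub_closure hu => n; exists n.
suff hw n : h (x n) = w (x n).
  by move=> N; have [n Nn hn] := Ah N; exists n; rewrite // -hw.
apply/eqP; rewrite -subr_eq0 -normr_eq0 -[_ == 0]negbK; apply/negP => r0.
set r := `|_ - _| in r0.
have {}r0 : 0 < r / 2 by rewrite divr_gt0// lt_def r0 normr_ge0.
have [N _ Nr] := near_infty_natSinv_lt (PosNum r0).
have [|_ [[k /Nr kr <-] /(_ (x n))]] :=
  hu (u @` [set k | (N <= k)%N]) _ _ (nbhs_uniform h r0).
  by exists N => // k Nk; exists k.
have := uw k n; move: kr => /=; move: (k.+1%:R^-1) => a.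
have : r <= `|u k (x n) - h (x n)| + `|u k (x n) - w (x n)|.
  by rewrite [X in _ <= X + _]distrC ler_distD.
lra.
Qed.

End not_countably_compact.

Lemma countably_tight_countably_compact (R : realType) (X : topologicalType) :
  tychonoff_space X -> countably_tight (graph_space X R) ->
  countably_compact_space X.
Proof.
move=> tX ct; apply: contrapT => /not_countably_compact_seq[x lfx].
have [B [BA cB clB]] := ct _ _ (@closure_io_nonzero0 R X x tX).
have [|u Bu] := countable_range_seq cB.
  by have [b [Bb _]] := clB _ filterT; exists b.
apply: (@not_io_nonzero0 R X x).
apply: (closure_range_io_nonzero tX lfx) => [k|].
  by apply: BA; rewrite Bu; exists k.
by rewrite -Bu.
Qed.

(** Otherwise [io_nonzero x] has a relatively closed trace on each compact [K]: a point of [K]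
    adherent to the trace is a uniform limit of members, and these cluster by compactness. *)
Lemma k_space_countably_compact (R : realType) (X : topologicalType) :
  tychonoff_space X -> k_space (graph_space X R) ->
  countably_compact_space X.
Proof.
move=> tX kC; apply: contrapT => /not_countably_compact_seq[x lfx].
apply: (@closed_io_nonzeroN R X x tX); apply: kC => K cK w.
rewrite closure_subspaceW; last by move=> ? [].
move=> [clw Kw]; split => //.
have /choice[u uP] k : exists g : graph_space X R, [/\ io_nonzero x g, K g &
    forall y, `|g y - w y| < k.+1%:R^-1].
  have k0 : 0 < k.+1%:R^-1 :> R by rewrite invr_gt0.
  by have [g [[Ag Kg] gw]] := clw _ (nbhs_uniform w k0); exists g.
apply: (@io_nonzero_cluster R X x tX lfx u) => [k|k n|].
- by have [] := uP k.
- by have [_ _] := uP k; apply.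
- have [|h [_ hu]] := cK (u @ \oo) _; last by exists h.
  by exists 0%N => // k _; have [] := uP k.
Qed.

(** Members of [io_nonzero x] chosen in [U k] and uniformly within 1/(k+1) of zero would cluster,
    putting zero in [io_nonzero x]. *)
Lemma q_space_countably_compact (R : realType) (X : topologicalType) :
  tychonoff_space X -> q_space (graph_space X R) ->
  countably_compact_space X.
Proof.
move=> tX qC; apply: contrapT => /not_countably_compact_seq[x lfx].
pose zero : graph_space X R := (cst 0 : continuousType X R).
have [U [Uz Uclu]] := qC zero.
have /choice[u uP] k : exists g : graph_space X R, [/\ io_nonzero x g, U k g &
    forall y, `|g y - zero y| < k.+1%:R^-1].
  have k0 : 0 < k.+1%:R^-1 :> R by rewrite invr_gt0.
  have [g [Ag [Ug gz]]] := @closure_io_nonzero0 R X x tX _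
    (filterI (open_nbhs_nbhs (Uz k)) (nbhs_uniform zero k0)).
  by exists g.
apply: (@not_io_nonzero0 R X x).
apply: (@io_nonzero_cluster R X x tX lfx u) => [k|k n|].
- by have [] := uP k.
- by have [_ _] := uP k; apply.
- by apply: Uclu => k; have [] := uP k.
Qed.

(** * The uniform metric and countably compact spaces *)

Section uniform_metric.
Import numFieldNormedType.Exports.
Variables (R : realType) (X : topologicalType).
Local Notation C := (graph_space X R).
Implicit Types f g h : C.

(* [0] is adjoined so that the supremum is not taken over the empty set when
   [X] is empty. *)
Let dists f g : set R := 0 |` range (fun y => Num.min 1 `|f y - g y|).

(** Truncation at 1 keeps the supremum finite when the difference is unbounded. *)
Definition unif_dist f g : R := sup (dists f g).

Lemma unif_dist_ub f g y : Num.min 1 `|f y - g y| <= unif_dist f g.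
Proof.
apply: ub_le_sup; last by right; exists y.
by exists 1 => _ [->|[z _ <-]] //; rewrite ge_min lexx.
Qed.

Lemma unif_dist_le f g e : 0 <= e ->
  (forall y, Num.min 1 `|f y - g y| <= e) -> unif_dist f g <= e.
Proof.
move=> e0 fge; apply: ge_sup; first by exists 0; left.
by move=> _ [->|[y _ <-]].
Qed.

Lemma unif_dist_ge0 f g : 0 <= unif_dist f g.
Proof.
apply: ub_le_sup; last by left.
by exists 1 => _ [->|[z _ <-]] //; rewrite ge_min lexx.
Qed.

Lemma unif_dist_lt1 f g e y : e <= 1 -> unif_dist f g < e -> `|f y - g y| < e.
Proof.
move=> e1 /(le_lt_trans (unif_dist_ub f g y)); rewrite gt_min => /orP[|//].
by rewrite ltNge e1.
Qed.

Lemma unif_dist_eq0 f g : unif_dist f g = 0 <-> f = g.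
Proof.
split=> [fg0|->]; last first.
  apply/eqP; rewrite eq_le unif_dist_ge0 andbT; apply: unif_dist_le => // y.
  by rewrite subrr normr0 ge_min lexx orbT.
apply/continuousEP => y; apply/eqP; rewrite -subr_eq0 -normr_le0.
by have := unif_dist_ub f g y; rewrite fg0 ge_min ler10.
Qed.

Lemma unif_distC f g : unif_dist f g = unif_dist g f.
Proof.
rewrite /unif_dist /dists.
suff -> : (fun y => Num.min 1 `|f y - g y|) = (fun y => Num.min 1 `|g y - f y|).
  by [].
by apply/funext => y; rewrite distrC.
Qed.

Lemma unif_dist_triangle f g h :
  unif_dist f h <= unif_dist f g + unif_dist g h.
Proof.
apply: unif_dist_le => [|y]; first by rewrite addr_ge0// unif_dist_ge0.
have := unif_dist_ub f g y; have := unif_dist_ub g h y.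
have := ler_distD (g y) (f y) (h y).
have := unif_dist_ge0 f g; have := unif_dist_ge0 g h.
rewrite !ge_min => ? ? ?.
by move=> /orP[?|?] /orP[?|?]; apply/orP; (try by left; lra); right; lra.
Qed.

(** The interiors of the sets [V n], over which a tube of radius 1/(n+1) fits in [U], cover [X]. The
    largest index in a finite subcover gives a radius valid everywhere. *)
Lemma countably_compact_tube f (U : set (X * R)) : countably_compact_space X ->
  open U -> graph_of f `<=` U ->
  exists2 e, 0 < e & forall y t, `|t - f y| < e -> U (y, t).
Proof.
move=> ccX oU fU.
pose V n := [set y | forall t, `|t - f y| < n.+1%:R^-1 -> U (y, t)].
have [|||D _ Dcov] := ccX nat setT (fun n => (V n)°).
- exact: countableP.
- by move=> n _; exact: open_interior.
- move=> y _.
  have [[A B] /= [nA /nbhs_ballP[d /= d0 dB]] ABU] : nbhs (y, f y) U.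
    by apply: open_nbhs_nbhs; split => //; apply: fU.
  (* One half of [d] absorbs the variation of [f] near [y], the other the radius of the tube. *)
  have d2 : 0 < d / 2 by rewrite divr_gt0.
  have [N _ /(_ N (leqnn N)) /= Nd] := near_infty_natSinv_lt (PosNum d2).
  exists N => //; rewrite /interior.
  have nf : \forall z \near y, `|f y - f z| < d / 2.
    by have /cvgrPdist_lt := @cts_fun _ _ (f : continuousType X R) y; apply.
  apply: filterS (filterI nA nf) => z [Az fz] t tz; apply: ABU; split => //=.
  apply: dB; rewrite /ball /=; have := ler_distD (f z) (f y) t.
  rewrite (distrC (f z) t); move: (N.+1%:R^-1) Nd tz => a; lra.
pose N := \max_(n <- finmap.enum_fset D) n.
exists N.+1%:R^-1 => [|y t ytN]; first by rewrite invr_gt0.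
have [n nD /interior_subset] := Dcov y Logic.I; apply.
apply: lt_le_trans ytN _; rewrite lef_pV2 ?posrE ?ltr0n// ler_nat ltnS.
exact: (@leq_bigmax_seq _ _ xpredT id).
Qed.

Lemma countably_compact_metrizable :
  countably_compact_space X -> metrizable_space R C.
Proof.
move=> ccX; exists unif_dist; split.
- exact: unif_dist_eq0.
- exact: unif_distC.
- by move=> f g h; exact: unif_dist_triangle.
- move=> f; apply/seteqP; split => A.
    move=> /nbhs_graphP[U [oU fU] UA].
    have [e e0 eU] := countably_compact_tube ccX oU fU.
    (* A radius at most 1 makes the truncation in [unif_dist] harmless. *)
    exists (Num.min e 1); first by rewrite /= lt_min e0 ltr01.
    move=> g /= fg; apply: UA => -[y t]; rewrite /graph_of /= => ->.
    apply: eU; rewrite distrC.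
    have := unif_dist_lt1 y _ fg; rewrite ge_min lexx orbT lt_min.
    by move=> /(_ isT)/andP[].
  move=> [e /= e0 eA].
  have e2 : 0 < e / 2 by rewrite divr_gt0.
  apply: filterS (nbhs_uniform f e2) => g gf; apply: eA => /=.
  apply: (@le_lt_trans _ _ (e / 2)); last by lra.
  apply: unif_dist_le => [|y]; first exact: ltW.
  by rewrite ge_min distrC; apply/orP; right; apply: ltW.
Qed.

End uniform_metric.

(** * Compactifications of Tychonoff spaces *)

Lemma compact_set_type (T : topologicalType) (A : set T) :
  compact A -> compact [set: set_type A].
Proof.
move=> cA F FF _.
have [|p [Ap Fp]] := cA (set_val @ F) _.
  apply: (@filterS _ F _ setT); last exact: filterT.
  by move=> [y yA] _; exact: set_mem.
exists (exist _ p (mem_set Ap)); split => // G W FG.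
rewrite nbhsE => -[_ [[V oV <-] Vp] VW].
have [||_ [[y Gy <-] Vy]] := Fp (set_val @` G) V _ _.
- by apply: (@filterS _ F _ G) => // y Gy; exists y.
- by apply: open_nbhs_nbhs; split.
- by exists y; split => //; exact: VW.
Qed.

Lemma hausdorff_set_type (T : topologicalType) (A : set T) :
  hausdorff_space T -> hausdorff_space (set_type A).
Proof.
move=> hT p q pq; apply: val_inj; apply: hT => V W nV nW.
have cval := @initial_continuous (set_type A) T set_val.
have [y [Vy Wy]] := pq _ _ (cval p _ nV) (cval q _ nW).
by exists (val y).
Qed.

(** This is the Stone-Čech construction: evaluation at all continuous functions into [0, 1] embeds
    [T] in a cube, and the closure of the image is compact. *)
Lemma tychonoff_space_compactification (R : realType) (T : topologicalType) :
  tychonoff_space T -> exists (K : topologicalType) (f : T -> K),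
    compactification f.
Proof.
move=> [/(completely_regular_spaceP R) crT aT].
pose I := {classic
  {f : T -> R | continuous f /\ forall y, `[0, 1]%classic (f y)}}.
pose ev (i : I) : T -> R := sval i.
have cev (i : I) : continuous (ev i) by case: (svalP i).
have sepev : separate_points_from_closed ev.
  move=> B a cB nBa; have [f [cf f01 fa f1]] := crT a B cB nBa.
  have fP : continuous f /\ forall y, `[0, 1]%classic (f y).
    by split => // y; apply: f01; exists y.
  exists (exist _ f fP : I); rewrite /ev /= fa => cl0.
  have : closure [set (1 : R)] 0 by exact: closureS cl0.
  have /closure_id <- : closed [set (1 : R)].
    exact: accessible_closed_set1 (hausdorff_accessible (@Rhausdorff R)) _.
  by move=> /esym/eqP; rewrite oner_eq0.
pose j := join_product ev.
pose A := closure (range j).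
have jA t : j t \in A by apply/mem_set/subset_closure; exists t.
have hP : hausdorff_space (prod_topology (fun _ : I => R)).
  by apply: (@hausdorff_product I (fun=> R)) => i; exact: Rhausdorff.
pose cube : set (prod_topology (fun _ : I => R)) :=
  [set g | forall i, `[0, 1]%classic (g i)].
have ccube : compact cube.
  apply: (@tychonoff I (fun=> R) (fun=> `[0, 1]%classic)) => i.
  exact: segment_compact.
have cA : compact A.
  apply: (subclosed_compact _ ccube); first exact: closed_closure.
  have /closure_id -> : closed cube by exact: (compact_closed hP ccube).
  by apply: closureS => _ [t _ <-] i; have [_] := svalP i; apply.
pose f t : set_type A := exist _ (j t) (jA t).
exists (set_type A), f; split.
- exact: compact_set_type.
- exact: hausdorff_set_type.
- split.
  + move=> s t /(congr1 val) /= jst.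
    by apply: (join_product_inj sepev aT) => //; rewrite inE.
  + move=> t W; rewrite nbhsE => -[_ [[V oV <-] Vt] VW].
    have nV : nbhs (j t) V by apply: open_nbhs_nbhs; split.
    apply: (@filterS _ (nbhs t) _ (j @^-1` V)) => [s Vs|]; first exact: VW.
    exact: join_product_continuous nV.
  + move=> B /(join_product_open sepev)/open_subspaceP[V oV VB].
    apply/open_subspaceP; exists (set_val @^-1` V); first by exists V.
    apply/seteqP; split => p [Bp [t _ ft]]; move: Bp; rewrite -{}ft {p}.
      move=> Vt; split; last by exists t.
      have : (V `&` range j) (j t) by split => //; exists t.
      rewrite VB => -[[s Bs jst] _]; exists s => //.
      exact: val_inj.
    move=> [s Bs fst]; split; last by exists t.
    have : (j @` B `&` range j) (j t).
      by split; [exists s => //; exact: (congr1 val fst)|exists t].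
    by rewrite -VB => -[].
- move=> W [[p pA] +] [V oV VW]; rewrite -VW => Vp.
  have [|_ [[t _ <-] Vt]] := set_mem pA V.
    by apply: open_nbhs_nbhs; split.
  by exists (f t); split => //; exists t.
Qed.

(** * Metrizable spaces, p-spaces and q-spaces *)

Section metrizable.
Import numFieldNormedType.Exports.
Variables (R : realType) (T : topologicalType).
Hypothesis mT : metrizable_space R T.

Lemma metrizable_first_countable : first_countable T.
Proof.
have [d [_ _ _ dnbhs]] := mT => x.
exists (range (fun n => [set y | d x y < n.+1%:R^-1])); split.
- exact: card_image_le.
- move=> _ [n _ <-]; rewrite dnbhs; exists n.+1%:R^-1 => //.
  by rewrite /= invr_gt0.
- move=> A; rewrite dnbhs => -[e /= e0 eA].
  have [N _ /(_ N (leqnn N)) /= Ne] := near_infty_natSinv_lt (PosNum e0).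
  exists [set y | d x y < N.+1%:R^-1]; first by exists N.
  by move=> y /= xy; apply: eA => /=; exact: lt_trans Ne.
Qed.

Lemma metrizable_tychonoff : tychonoff_space T.
Proof.
have [d [d0 dC dD dnbhs]] := mT.
(* Nonnegativity comes from the triangle x, y, x: 0 = d x x <= 2 d x y. *)
have dge0 x y : 0 <= d x y.
  by have := dD x y x; rewrite (dC y x) (d0 x x).2 //; lra.
split.
  apply/(completely_regular_spaceP R) => a B cB nBa.
  have : nbhs a (~` B) by apply: open_nbhs_nbhs; split => //; rewrite openC.
  rewrite dnbhs => -[r /= r0 rB].
  exists (fun y => Num.min 1 (d a y / r)); split.
  - move=> y; apply/cvgrPdist_le => e e0.
    change (nbhs y
      [set z | `|Num.min 1 (d a y / r) - Num.min 1 (d a z / r)| <= e]).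
    (* The quotient d a y / r is Lipschitz in [y] with constant 1/r, and truncation at 1 does not
       increase differences. *)
    rewrite dnbhs; exists (e * r) => /=; first by rewrite mulr_gt0.
    move=> z /= yz; have h1 : d a y / r <= d a z / r + e.
      rewrite -[e](mulfK (lt0r_neq0 r0)) -mulrDl ler_pM2r ?invr_gt0//.
      by have := dD a z y; rewrite (dC z y); lra.
    have h2 : d a z / r <= d a y / r + e.
      rewrite -[e](mulfK (lt0r_neq0 r0)) -mulrDl ler_pM2r ?invr_gt0//.
      by have := dD a y z; lra.
    move: (d a y / r) (d a z / r) h1 h2 => s t h1 h2.
    rewrite /Num.min; case: ifPn => s1; case: ifPn => t1;
      rewrite -?leNgt in s1 t1; rewrite ler_norml; apply/andP; split; lra.
  - move=> _ [y _ <-]; rewrite /= in_itv /= ge_min lexx andbT le_min ler01.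
    by rewrite divr_ge0// ltW.
  - by rewrite (d0 a a).2// mul0r; apply/min_idPr.
  - move=> _ [y By <-]; apply/min_idPl; rewrite ler_pdivlMr// mul1r leNgt.
    by apply/negP => /rB.
move=> x y /eqP xy; exists (~` [set y]); split.
- rewrite openC => z cz; apply/d0/eqP; rewrite eq_le dge0 andbT leNgt.
  apply/negP => zy; have [|w [-> /=]] := cz [set w | d z w < d z y].
    by rewrite dnbhs; exists (d z y).
  by rewrite ltxx.
- by rewrite inE.
- by rewrite inE; apply.
Qed.

(* A point [y] sharing with [f z] open sets whose traces on [T] are arbitrarily
   small equals [f z]: by density each neighbourhood of [y] meets those traces,
   hence every ball around [z]. *)
Lemma metrizable_p_space : p_space T.
Proof.
split; first exact: metrizable_tychonoff.
have [d [d0 dC dD dnbhs]] := mT.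
have [K [f [cK hK [finj cf fo] df]]] :=
  @tychonoff_space_compactification R T metrizable_tychonoff.
exists K, f; split => //.
exists (fun n => [set V | open V /\
  forall s t, V (f s) -> V (f t) -> d s t <= n.+1%:R^-1]); split.
- by move=> n V [].
- move=> n _ [z _ <-]; pose e : R := n.+1%:R^-1 / 2.
  have e0 : 0 < e by rewrite divr_gt0// invr_gt0.
  have nz : nbhs z [set y | d z y < e] by rewrite dnbhs; exists e.
  have /fo/open_subspaceP[V oV Vz] := open_interior [set y | d z y < e].
  have Ve s : V (f s) -> d z s < e.
    move=> Vs; have : (V `&` range f) (f s) by split => //; exists s.
    by rewrite Vz => -[[t /interior_subset + /finj <-]].
  exists V.
    split => // s t /Ve zs /Ve zt; apply: le_trans (dD s z t) _.
    by rewrite dC; move: zs zt; rewrite /e; move: (n.+1%:R^-1) => a; lra.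
  have : (f @` [set y | d z y < e]° `&` range f) (f z).
    by split; exists z => //; rewrite /interior.
  by rewrite -Vz => -[].
- move=> z y Uy; exists z => //; apply: hK => P Q nP nQ.
  have : nbhs z (f @^-1` P) by exact: cf.
  rewrite dnbhs => -[e /= e0 eP].
  have [N _ /(_ N (leqnn N)) /= Ne] := near_infty_natSinv_lt (PosNum e0).
  have [V [[oV Vd] Vz] Vy] := Uy N Logic.I.
  have [|p [[Qt Vt] [t _ ft]]] := df (Q° `&` V) _ (openI (open_interior _) oV).
    by exists y; split.
  rewrite -ft in Qt Vt; exists (f t); split; last exact: interior_subset Qt.
  by apply: eP; apply: le_lt_trans Ne; apply: Vd.
Qed.

End metrizable.

(** Regularity of [K] shrinks a member [V n] around [f z] to [W n] with closure inside it. A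
    sequence running through the traces of the first n+1 sets [W k] clusters in [K], at a point of
    every [V n], hence in [range f]; the embedding carries it back to [T]. *)
Lemma p_space_q_space (T : topologicalType) : p_space T -> q_space T.
Proof.
move=> [_ [K [f [[cK hK [finj cf fo] df] [U [Uo Ucov Usub]]]]]] z.
have /choice[V VP] n : exists V, U n V /\ V (f z).
  by have [|V UV Vz] := Ucov n (f z); [exists z|exists V].
have /choice[W WP] n : exists W, nbhs (f z) W /\ closure W `<=` V n.
  have [] := @compact_regular K (f z) setT hK cK filterT (V n).
    by apply: open_nbhs_nbhs; have [/Uo ? ?] := VP n; split.
  by move=> W nW WV; exists W.
pose B n := (f @^-1` (\bigcap_(k in `I_n.+1) W k))°.
exists B; split => [n|u uB].
  split; first exact: open_interior.
  by apply: cf; apply: filter_bigcap_nat => k; have [] := WP k.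
have [|y [_ yu]] := cK (f \o u @ \oo) _; first exact: filterT.
have yW k : closure (W k) y.
  move: yu; rewrite clusterE => /(_ (W k)); apply; exists k => // n /= kn.
  by have /interior_subset /(_ k) := uB n; apply; rewrite /= ltnS.
have [t _ fty] : range f y.
  by apply: (Usub z) => n _; exists (V n) => //; have [_] := WP n; apply.
exists t => G A uG nA.
have /fo/open_subspaceP[P oP PA] := open_interior A.
have [||_ [[s Gs <-] Ps]] := yu (f @` G) P.
- by apply: (@filterS _ \oo _ (u @^-1` G)) => // n Gn; exists (u n).
- apply: open_nbhs_nbhs; split => //; rewrite -fty.
  have : (f @` A° `&` range f) (f t) by split; exists t.
  by rewrite -PA => -[].
exists s; split => //.
have : (P `&` range f) (f s) by split => //; exists s.
by rewrite PA => -[[r /interior_subset + /finj <-]].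
Qed.

(** * The cycle of equivalences *)

Theorem theorem5p1 (R : realType) (X : topologicalType) :
  tychonoff_space X ->
  [<-> metrizable_space R (graph_space X R);
       p_space (graph_space X R);
       q_space (graph_space X R);
       first_countable (graph_space X R);
       frechet_space (graph_space X R);
       sequential_space (graph_space X R);
       k_space (graph_space X R);
       countably_tight (graph_space X R);
       countably_compact_space X].
Proof.
move=> tX; have m9 := @countably_compact_metrizable R X.
tfae.
- exact: metrizable_p_space.
- exact: p_space_q_space.
(* This implication, like that from k-space to countable tightness, passes through countable
   compactness and metrizability. *)
- by move/(q_space_countably_compact tX)/m9/metrizable_first_countable.
- exact: first_countable_frechet.
- exact: frechet_sequential.
- exact: sequential_k_space.
- move/(k_space_countably_compact tX)/m9/metrizable_first_countable.
  by move/first_countable_frechet/frechet_countably_tight.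
- exact: countably_tight_countably_compact.
- exact: m9.
Qed.
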